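(* Let $x$ be an allocation rule and suppose Assumptions D, X and T hold. Consider the Optimal Transfer Problem (P): maximize $\sum_{i=1}^2\int_\Theta T_i(\theta)\,dP(\theta)$ over transfer rules $t$ such that (i) $(x,t)$ is feasible and (ii) $t\in\mathcal{T}$. Consider also the Reduced Problem (R): maximize $\sum_{i=1}^2\int_\Theta T_i(\theta)\,dP(\theta)$ over transfer rules $t$ such that (i) $t$ is win-lose dependent (for $x$), (ii) $U_i^{\min}(\theta)=\int_{\underline\theta}^{\theta}X_i^{\min}(z)\,dz$ for every $i$ and every $\theta\in\Theta$, and (iii) $t\in\mathcal{T}$. Then every solution (maximizer) of problem (R) is a solution of problem (P).
   Context: Let $\Theta=[\underline\theta,\bar\theta]\subset\mathbb{R}$ with $0<\underline\theta<\bar\theta$, with Borel $\sigma$-algebra $\mathcal{B}$; ''$\sigma$-algebra'' always means a sub-$\sigma$-algebra of $\mathcal{B}$, and $\Delta(\Theta,\mathcal{A})$ is the set of probability measures on $(\Theta,\mathcal{A})$. For $\mathcal{E}\subset\mathcal{A}$ and $P\in\Delta(\Theta,\mathcal{A})$, $P_{\mathcal{E}}$ denotes the restriction of $P$ to $\mathcal{E}$. A divergence $D$ assigns to each pair $Q,P$ of probability measures on a common $\sigma$-algebra a number $D(Q\|P)\in[0,\infty]$. Assumption D: for every $\sigma$-algebra $\mathcal{A}$ and $P,Q\in\Delta(\Theta,\mathcal{A})$: (D1) $D(Q\|P)=0$ if $Q=P$; (D2) if $Q\ll P$ and $dQ/dP$ is bounded, then $\epsilon\mapsto D(\epsilon Q+(1-\epsilon)P\|P)$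 is continuous on $[0,1]$; (D3) if $D(Q\|P)<\infty$ then $Q\ll P$; (D4) for every sub-$\sigma$-algebra $\mathcal{E}\subset\mathcal{A}$, $D(Q_{\mathcal{E}}\|P_{\mathcal{E}})\le D(Q\|P)$; (D5) for every sub-$\sigma$-algebra $\mathcal{E}\subset\mathcal{A}$, $D(Q_{\mathcal{E}}\|P_{\mathcal{E}})=D(Q\|P)$ if $dQ_{\mathcal{E}}/dP_{\mathcal{E}}=dQ/dP$ $P$-a.e. Fix an atomless $P\in\Delta(\Theta,\mathcal{B})$ (the reference belief) and $\eta>0$; ''a.e.'' means with respect to $P$ (or $P\otimes P$). There are two bidders $i\in\{1,2\}$. An allocation rule is a bounded measurable $x=(x_1,x_2):\Theta^2\to\mathbb{R}^2$ with $x_1(\theta,\theta')\ge0$, $x_2(\theta',\theta)\ge0$, $x_1(\theta,\theta')+x_2(\theta',\theta)\le1$ for all $\theta,\theta'$; a transfer rule is a bounded measurable $t=(t_1,t_2):\Theta^2\to\mathbb{R}^2$ ($x_i(\theta,\theta')$, $t_i(\theta,\theta')$ are bidder $i$'s winning probability and payment when she reports $\theta$ and the other reports $\theta'$). Define $X_i(\theta)=\int x_i(\theta,\theta')dP(\theta')$, $X_i^{\min}(\theta)=\inf_Q\{\int x_i(\theta,\theta')dQ(\theta'):D(Q\|P)\le\eta\}$, $U_i^{\min}(\theta)=\inf_Q\{\int[\theta x_i(\theta,\theta')-t_i(\theta,\theta')]dQ(\theta'):D(Q\|P)\le\eta\}$, $T_i(\theta)=\int t_i(\theta,\theta')dP(\theta')$,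 where $Q$ ranges over $\Delta(\Theta,\mathcal{B})$. $(x,t)$ is incentive compatible if for all $i,\theta$, $\theta$ maximizes over $\hat\theta\in\Theta$ the quantity $\inf_Q\{\int[\theta x_i(\hat\theta,\theta')-t_i(\hat\theta,\theta')]dQ(\theta'):D(Q\|P)\le\eta\}$; individually rational if $U_i^{\min}(\theta)\ge0$ for all $i,\theta$; feasible if both hold. Assumption X (on $x$): (i) $x_i(\theta,\theta')\in\{0,1\}$ whenever $\theta'\neq\theta$; (ii) $X_i(\theta)=1$ implies $\theta=\bar\theta$; (iii) $X_i^{\min}$ is non-decreasing. Assumption T: constants $0\le\alpha\le\beta\le1$, $K\ge0$ are given, and $\mathcal{T}$ is the class of transfer rules $t$ such that for every $i$, every $\theta<\bar\theta$ and all $\theta^w,\theta^l$ with $x_i(\theta,\theta^w)=1$ and $x_i(\theta,\theta^l)=0$, one has $\alpha t_i(\theta,\theta^w)-\beta t_i(\theta,\theta^l)\le K$. A transfer rule $t$ is win-lose dependent (for $x$) if there exist $t_i^w,t_i^l:\Theta\to\mathbb{R}$ with $t_i(\theta,\theta')=t_i^w(\theta)x_i(\theta,\theta')+t_i^l(\theta)[1-x_i(\theta,\theta')]$ and $\theta-t_i^w(\theta)\ge-t_i^l(\theta)$ for all $i,\theta,\theta'$. *)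

(* Defs.v *)
From HB Require Import structures.
From mathcomp Require Import all_boot all_order all_algebra.
From mathcomp Require Import all_classical all_reals all_analysis.
Set Implicit Arguments. Unset Strict Implicit. Unset Printing Implicit Defensive.
Import Order.TTheory GRing.Theory Num.Theory.
Import numFieldNormedType.Exports.
Local Open Scope classical_set_scope.
Local Open Scope ring_scope.

Section Model.
Context {R : realType}.
Variables (a b : R).

Definition Theta : set R := `[a, b].

Definition BorelTheta : set (set R) := [set S | S `<=` Theta /\ measurable S].

Definition sub_sigma (A : set (set R)) : Prop :=
  [/\ sigma_algebra Theta A, (forall S, A S -> S `<=` Theta)
    & (forall S, A S -> BorelTheta S)].

(** Measurable space (Theta, A); the carrier is R, probability measures on
   (Theta, A) are the probability measures on it giving mass 1 to Theta. *)
End Model.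
Definition gsT {R : realType} (A : set (set R)) : measurableType (sigma_display A) :=
  g_sigma_algebraType (A : set (set (R : pointedType))).
Section Model2.
Context {R : realType}.
Variables (a b : R).
Local Notation Theta := (Theta a b).
Local Notation BorelTheta := (BorelTheta a b).
Local Notation sub_sigma := (sub_sigma a b).

Definition isProbTheta (A : set (set R)) (P : probability (gsT A) R) : Prop :=
  P (Theta : set (gsT A)) = 1%E.

(** A divergence: for a sigma-algebra A and two (set functions representing)
   probability measures on (Theta, A), a value in \bar R. *)
Definition divergence := set (set R) -> (set R -> \bar R) -> (set R -> \bar R) -> \bar R.

(** Restriction of a set function to the sets of A (0 elsewhere): this is how
   a measure on (Theta, A) (or its restriction to a sub-sigma-algebra) is
   handed to a divergence, so that D(Q||P) only depends on Q, P on A. *)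
Definition restrict (A : set (set R)) (m : set R -> \bar R) : set R -> \bar R :=
  fun S => if `[< A S >] then m S else 0%E.

Definition Dv (D : divergence) (A : set (set R)) (Q P : set R -> \bar R) : \bar R :=
  D A (restrict A Q) (restrict A P).

Definition is_density (E A : set (set R)) (P : probability (gsT A) R)
  (Q : set R -> \bar R) (f : R -> R) : Prop :=
  measurable_fun (Theta : set (gsT E)) (f : gsT E -> R) /\
  forall S, E S -> Q S = (\int[P]_(x in (S : set (gsT A))) (f x)%:E)%E.

Definition assumptionD (D : divergence) : Prop :=
  forall A, sub_sigma A ->
  forall P Q : probability (gsT A) R, isProbTheta P -> isProbTheta Q ->
      (0 <= Dv D A Q P)%E /\
  [/\
      ((forall S, A S -> Q S = P S) -> Dv D A Q P = 0%E),
      ((exists f M, is_density A P Q f /\ (forall x, Theta x -> `|f x| <= M)) ->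
        {within `[0, 1], continuous
          (fun e : R => Dv D A (fun S => (e%:E * Q S + (1 - e)%:E * P S)%E) P)}),
      ((Dv D A Q P < +oo)%E -> forall S, A S -> P S = 0%E -> Q S = 0%E),
      (forall E, sub_sigma E -> E `<=` A -> (Dv D E Q P <= Dv D A Q P)%E) &
      (forall E, sub_sigma E -> E `<=` A ->
        (exists f g, [/\ is_density E P Q f, is_density A P Q g &
           {ae P, forall x, Theta x -> f x = g x}]) ->
        Dv D E Q P = Dv D A Q P)].

Definition atomless (P : probability (gsT BorelTheta) R) : Prop :=
  forall S : set (gsT BorelTheta), measurable S -> (0 < P S)%E ->
  exists S' : set (gsT BorelTheta), [/\ measurable S', S' `<=` S &
    (0 < P S' < P S)%E].

Section Auction.
Variables (D : divergence) (P : probability (gsT BorelTheta) R) (eta : R).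

Definition worst_case (g : R -> R) : \bar R :=
  ereal_inf [set v | exists Q : probability (gsT BorelTheta) R,
    [/\ isProbTheta Q, (Dv D BorelTheta Q P <= eta%:E)%E &
        v = (\int[Q]_(y in (Theta : set (gsT BorelTheta))) (g y)%:E)%E]].

Definition bidder1 : 'I_2 := ord0.
Definition bidder2 : 'I_2 := ord_max.

Definition bounded_measurable (f : R -> R -> R) : Prop :=
  measurable_fun (Theta `*` Theta : set (R * R)) (fun p : R * R => f p.1 p.2) /\
  exists M : R, forall th th', Theta th -> Theta th' -> `|f th th'| <= M.

(** x i th th' : winning probability of bidder i reporting th, other th'. *)
Definition allocation_rule (x : 'I_2 -> R -> R -> R) : Prop :=
  (forall i, bounded_measurable (x i)) /\
  forall th th', Theta th -> Theta th' ->
    [/\ 0 <= x bidder1 th th', 0 <= x bidder2 th' th &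
        x bidder1 th th' + x bidder2 th' th <= 1].

Definition transfer_rule (t : 'I_2 -> R -> R -> R) : Prop :=
  forall i, bounded_measurable (t i).

Definition Xexp (x : 'I_2 -> R -> R -> R) i th : \bar R :=
  (\int[P]_(y in (Theta : set (gsT BorelTheta))) (x i th y)%:E)%E.

Definition Xmin (x : 'I_2 -> R -> R -> R) i th : \bar R := worst_case (x i th).

Definition Urep (x t : 'I_2 -> R -> R -> R) i th thhat : \bar R :=
  worst_case (fun y => th * x i thhat y - t i thhat y).

Definition Umin (x t : 'I_2 -> R -> R -> R) i th : \bar R := Urep x t i th th.

Definition Texp (t : 'I_2 -> R -> R -> R) i th : \bar R :=
  (\int[P]_(y in (Theta : set (gsT BorelTheta))) (t i th y)%:E)%E.

Definition incentive_compatible (x t : 'I_2 -> R -> R -> R) : Prop :=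
  forall i th thhat, Theta th -> Theta thhat -> (Urep x t i th thhat <= Urep x t i th th)%E.

Definition individually_rational (x t : 'I_2 -> R -> R -> R) : Prop :=
  forall i th, Theta th -> (0 <= Umin x t i th)%E.

Definition feasible (x t : 'I_2 -> R -> R -> R) : Prop :=
  incentive_compatible x t /\ individually_rational x t.

Definition assumptionX (x : 'I_2 -> R -> R -> R) : Prop :=
  [/\ (forall i th th', Theta th -> Theta th' -> th' != th ->
         x i th th' = 0 \/ x i th th' = 1),
      (forall i th, Theta th -> Xexp x i th = 1%E -> th = b) &
      (forall i th th', Theta th -> Theta th' -> th <= th' ->
         (Xmin x i th <= Xmin x i th')%E)].

Definition in_Tclass (alpha beta K : R) (x t : 'I_2 -> R -> R -> R) : Prop :=
  forall i th thw thl, Theta th -> th < b -> Theta thw -> Theta thl ->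
    x i th thw = 1 -> x i th thl = 0 ->
    alpha * t i th thw - beta * t i th thl <= K.

Definition win_lose_dependent (x t : 'I_2 -> R -> R -> R) : Prop :=
  exists tw tl : 'I_2 -> R -> R, forall i th, Theta th ->
    (forall th', Theta th' ->
       t i th th' = tw i th * x i th th' + tl i th * (1 - x i th th')) /\
    - tl i th <= th - tw i th.

Definition revenue (t : 'I_2 -> R -> R -> R) : \bar R :=
  (\sum_(i < 2) \int[P]_(th in (Theta : set (gsT BorelTheta))) Texp t i th)%E.

Definition admissibleP alpha beta K x t : Prop :=
  [/\ transfer_rule t, feasible x t & in_Tclass alpha beta K x t].

Definition admissibleR alpha beta K x t : Prop :=
  [/\ transfer_rule t, win_lose_dependent x t,
      (forall i th, Theta th ->
         Umin x t i th = (\int[lebesgue_measure]_(z in `[a, th]) Xmin x i z)%E)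
    & in_Tclass alpha beta K x t].

Definition solvesP alpha beta K x t : Prop :=
  admissibleP alpha beta K x t /\
  forall t', admissibleP alpha beta K x t' -> (revenue t' <= revenue t)%E.

Definition solvesR alpha beta K x t : Prop :=
  admissibleR alpha beta K x t /\
  forall t', admissibleR alpha beta K x t' -> (revenue t' <= revenue t)%E.

End Auction.
End Model2.

(* Main.v *)
(* Replace the payments of a feasible mechanism by their conditional means given
   winning and given losing. For a plausible belief Q, let Q' give the two events
   their Q-probabilities and agree with the reference P conditionally on each of
   them (Jeffrey's rule). The two-cell algebra is sufficient for (Q', P), hence
   D(Q'||P) <= D(Q||P) and Q' is plausible too; and the old payments are worth
   under Q' what the averaged ones are worth under Q. So averaging insures the
   bidder, and where winning is then still worse than losing, full insurance is
   even cheaper. Incentive compatibility makes X^min a subgradient of the utility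
   U, so U dominates the integral V of X^min, and adding a constant to both
   payments brings U down to V. The resulting transfers are admissible for the
   reduced problem and raise at least as much, type by type. Conversely, a
   win-lose dependent rule with utility V is incentive compatible because V is
   convex with slope X^min. *)

Require Import Defs.
From mathcomp Require Import all_boot all_order all_algebra.
From mathcomp Require Import all_classical all_reals all_analysis.
From mathcomp Require Import measurable_realfun ring lra.
Set Implicit Arguments.
Unset Strict Implicit.
Unset Printing Implicit Defensive.
Import Order.TTheory GRing.Theory Num.Theory.
Local Open Scope classical_set_scope.
Local Open Scope ring_scope.

Section BoundedMeasurable.
Context d (T : measurableType d) (R : realType).
Implicit Types (A : set T) (f g : T -> R).

Definition bounded_mfun A f : Prop :=
  measurable_fun A f /\ exists M : R, forall x, A x -> `|f x| <= M.

Lemma bounded_mfun_cst A (c : R) : bounded_mfun A (fun=> c).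
Proof. by split; [exact: measurable_cst | exists `|c|]. Qed.

Lemma bounded_mfun_indic A (W : set T) : measurable W ->
  bounded_mfun A (\1_W : T -> R).
Proof.
move=> mW; split; first exact: measurable_indic.
by exists 1 => x _; rewrite indicE normr_nat lern1 leq_b1.
Qed.

Lemma bounded_mfunD A f g : bounded_mfun A f -> bounded_mfun A g ->
  bounded_mfun A (fun x => f x + g x).
Proof.
move=> [mf [M fM]] [mg [N gN]]; split; first exact: measurable_funD.
by exists (M + N) => x Ax; rewrite (le_trans (ler_normD _ _))// lerD ?fM ?gN.
Qed.

Lemma bounded_mfunM A f g : bounded_mfun A f -> bounded_mfun A g ->
  bounded_mfun A (fun x => f x * g x).
Proof.
move=> [mf [M fM]] [mg [N gN]]; split; first exact: measurable_funM.
by exists (M * N) => x Ax; rewrite normrM ler_pM ?fM ?gN.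
Qed.

Lemma bounded_mfunN A f : bounded_mfun A f -> bounded_mfun A (fun x => - f x).
Proof.
move=> [mf [M fM]]; split; first exact: measurableT_comp.
by exists M => x Ax; rewrite normrN fM.
Qed.

Lemma bounded_mfun_max A f g : bounded_mfun A f -> bounded_mfun A g ->
  bounded_mfun A (fun x => Num.max (f x) (g x)).
Proof.
move=> [mf [M fM]] [mg [N gN]]; split; first exact: measurable_maxr.
exists (Num.max M N) => x Ax; rewrite le_max.
by case: (leP (f x) (g x)); rewrite ?fM ?gN ?orbT.
Qed.

Lemma bounded_mfun_if A (c : T -> bool) f g :
  measurable A -> measurable_fun A c -> bounded_mfun A f -> bounded_mfun A g ->
  bounded_mfun A (fun x => if c x then f x else g x).
Proof.
move=> mA mc [mf [M fM]] [mg [N gN]]; split.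
  apply: measurable_fun_if => //.
  - exact: measurable_funS mf.
  - exact: measurable_funS mg.
exists (Num.max M N) => x Ax; rewrite le_max.
by case: (c x); rewrite ?fM ?gN ?orbT.
Qed.

(* The quotient vanishes at the zeros of [g], as [0^-1 = 0]. *)
Lemma bounded_mfun_div A f g (M : R) :
  measurable_fun A f -> measurable_fun A g -> (forall x, A x -> 0 <= g x) ->
  (forall x, A x -> `|f x| <= M * g x) -> bounded_mfun A (fun x => f x / g x).
Proof.
move=> mf mg g0 fMg; split.
  apply: measurable_funM => //.
  apply: (eq_measurable_fun (fun x => g x `^ (-1))).
    by move=> x; rewrite inE => Ax; rewrite powR_inv1// g0.
  exact: measurableT_comp (measurable_powR _) mg.
exists `|M| => x Ax; have := g0 _ Ax; rewrite le_eqVlt => /predU1P[<-|gx].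
  by rewrite invr0 mulr0 normr0.
rewrite normrM normfV (gtr0_norm gx) ler_pdivrMr//.
by rewrite (le_trans (fMg _ Ax))// ler_wpM2r ?ler_norm// ltW.
Qed.

Lemma bounded_mfun_integrable (mu : {measure set T -> \bar R}) A f :
  measurable A -> (mu A < +oo)%E -> bounded_mfun A f ->
  mu.-integrable A (EFin \o f).
Proof.
move=> mA muA [mf [M fM]]; apply: measurable_bounded_integrable => //.
exists M; split; first exact: num_real.
by move=> N MN x Ax; exact: le_trans (fM _ Ax) (ltW MN).
Qed.

Lemma probability_bounded_mfun_integrable (P : probability T R) A f :
  measurable A -> bounded_mfun A f -> P.-integrable A (EFin \o f).
Proof.
move=> mA; apply: bounded_mfun_integrable => //.
by rewrite ltey_eq fin_num_measure.
Qed.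

End BoundedMeasurable.

Lemma bounded_mfun_comp d1 d2 (T1 : measurableType d1) (T2 : measurableType d2)
    (R : realType) (A1 : set T1) (A2 : set T2) (h : T1 -> T2) (f : T2 -> R) :
  measurable A2 -> measurable_fun A1 h -> h @` A1 `<=` A2 ->
  bounded_mfun A2 f -> bounded_mfun A1 (f \o h).
Proof.
move=> mA2 mh hA [mf [M fM]]; split; first exact: measurable_comp mf mh.
by exists M => x Ax; apply/fM/hA; exists x.
Qed.

#[local] Hint Resolve bounded_mfun_cst bounded_mfun_indic bounded_mfunD
  bounded_mfunM bounded_mfunN : bounded_mfun.
#[local] Hint Extern 0 (bounded_mfun _ _) =>
  solve [auto 12 with bounded_mfun nocore] : core.
#[local] Hint Extern 0 (is_true (integrable _ _ _)) =>
  solve [apply: probability_bounded_mfun_integrable => //] : core.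

Section Rintegral.
Context d (T : measurableType d) (R : realType).
Variables (mu : {measure set T -> \bar R}) (A : set T).
Hypothesis mA : measurable A.
Implicit Types f g : T -> R.

Lemma EFin_Rintegral f : mu.-integrable A (EFin \o f) ->
  (\int[mu]_(x in A) f x)%:E = (\int[mu]_(x in A) (f x)%:E)%E.
Proof. by move=> intf; rewrite fineK//; exact: integrable_fin_num. Qed.

Lemma ae_eq_Rintegral f g : measurable_fun A f -> measurable_fun A g ->
  {ae mu, forall x, A x -> f x = g x} ->
  \int[mu]_(x in A) f x = \int[mu]_(x in A) g x.
Proof.
move=> mf mg fg; congr fine; apply: ae_eq_integral => //.
- exact/measurable_EFinP.
- exact/measurable_EFinP.
- by apply: filterS fg => x fg Ax; rewrite fg.
Qed.

Lemma ae_le_Rintegral f g : mu.-integrable A (EFin \o f) ->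
  mu.-integrable A (EFin \o g) -> {ae mu, forall x, A x -> f x <= g x} ->
  \int[mu]_(x in A) f x <= \int[mu]_(x in A) g x.
Proof.
move=> intf intg fg; rewrite -subr_ge0 -RintegralB//.
have mgf : measurable_fun A (fun x => g x - f x).
  by apply: measurable_funB; apply/measurable_EFinP/(measurable_int mu).
rewrite (@ae_eq_Rintegral _ (fun x => `|g x - f x|))//.
- exact: Rintegral_ge0.
- exact: measurableT_comp.
- by apply: filterS fg => x fg Ax; rewrite ger0_norm// subr_ge0 fg.
Qed.

Lemma normr_le_Rintegral f g : mu.-integrable A (EFin \o f) ->
  mu.-integrable A (EFin \o g) -> (forall x, A x -> `|f x| <= g x) ->
  `|\int[mu]_(x in A) f x| <= \int[mu]_(x in A) g x.
Proof.
move=> intf intg fg; rewrite (le_trans (le_normr_Rintegral mA intf))//.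
by apply: le_Rintegral => //; exact: integrable_norm.
Qed.

End Rintegral.

Section ProbabilityMean.
Context d (T : measurableType d) (R : realType).
Variables (P : probability T R) (A : set T).
Hypotheses (mA : measurable A) (PA : P A = 1%E).
Implicit Types f g : T -> R.

Lemma Rintegral_prob_cst (c : R) : \int[P]_(x in A) c = c.
Proof. by rewrite Rintegral_cst//= PA mulr1. Qed.

Lemma Rintegral_affine (c e : R) f : P.-integrable A (EFin \o f) ->
  \int[P]_(x in A) (c * f x + e) = c * \int[P]_(x in A) f x + e.
Proof.
move=> intf; rewrite RintegralD// ?RintegralZl ?Rintegral_prob_cst//.
exact: (integrableZl _ c intf).
Qed.

Lemma Rintegral_onem f : P.-integrable A (EFin \o f) ->
  \int[P]_(x in A) (1 - f x) = 1 - \int[P]_(x in A) f x.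
Proof. by move=> intf; rewrite RintegralB// Rintegral_prob_cst. Qed.

Lemma Rintegral01 f : P.-integrable A (EFin \o f) ->
  (forall x, A x -> 0 <= f x <= 1) -> 0 <= \int[P]_(x in A) f x <= 1.
Proof.
move=> intf f01; rewrite Rintegral_ge0/=; last by move=> x /f01 /andP[].
rewrite -[leRHS](Rintegral_prob_cst 1); apply: le_Rintegral => //.
by move=> x /f01 /andP[].
Qed.

End ProbabilityMean.

Section ParametricIntegral.
Context d1 d2 (T1 : measurableType d1) (T2 : measurableType d2) (R : realType).
Variables (A1 : set T1) (A2 : set T2).
Hypotheses (mA1 : measurable A1) (mA2 : measurable A2).

Lemma measurable_fun_section_integral
    (m : {sigma_finite_measure set T2 -> \bar R}) (f : T1 * T2 -> \bar R) :
  measurable_fun (A1 `*` A2) f ->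
  measurable_fun A1 (fun x => \int[m]_(y in A2) f (x, y))%E.
Proof.
move=> mf; set F := f \_ (A1 `*` A2).
have mF : measurable_fun setT F.
  exact: (measurable_restrictT f (measurableX mA1 mA2)).1.
apply: (eq_measurable_fun (fun x => fubini_F m F^\+ x - fubini_F m F^\- x)%E).
  move=> x /set_mem A1x.
  have -> : (\int[m]_(y in A2) f (x, y) = \int[m]_y (F \o pair x) y)%E.
    rewrite integral_mkcond; apply: eq_integral => y _.
    by rewrite /F/= !patchE in_setX/= (mem_set A1x).
  by rewrite [RHS]integralE funepos_comp funeneg_comp.
apply: measurable_funTS; apply: emeasurable_funB.
- apply: measurable_fun_fubini_tonelli_F; first exact: measurable_funepos.
  exact: funepos_ge0.
- apply: measurable_fun_fubini_tonelli_F; first exact: measurable_funeneg.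
  exact: funeneg_ge0.
Qed.

Lemma bounded_mfun_section (h : T1 -> T2 -> R) x : A1 x ->
  bounded_mfun (A1 `*` A2) (fun p => h p.1 p.2) -> bounded_mfun A2 (h x).
Proof.
move=> A1x; apply: (@bounded_mfun_comp _ _ _ _ _ _ _ (pair x)).
- exact: measurableX.
- by apply: measurable_funTS; exact: measurable_pair1.
- by move=> _ [y A2y <-].
Qed.

Lemma bounded_mfun_fst (f : T1 -> R) : bounded_mfun A1 f ->
  bounded_mfun (A1 `*` A2) (fun p => f p.1).
Proof.
apply: (@bounded_mfun_comp _ _ _ _ _ _ _ fst) => //.
  by apply: measurable_funTS; exact: measurable_fst.
by move=> _ [p [A1p _] <-].
Qed.

Lemma bounded_mfun_Rintegral (P : probability T2 R) (h : T1 -> T2 -> R) :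
  bounded_mfun (A1 `*` A2) (fun p => h p.1 p.2) ->
  bounded_mfun A1 (fun x => \int[P]_(y in A2) h x y).
Proof.
move=> bh; have [mh [M hM]] := bh; split.
  apply: measurableT_comp; first exact: fine_measurable.
  apply: (@measurable_fun_section_integral _ (fun p => (h p.1 p.2)%:E)).
  exact/measurable_EFinP.
exists (M * fine (P A2)) => x A1x; rewrite -Rintegral_cst//.
have bhx := bounded_mfun_section A1x bh.
by apply: normr_le_Rintegral => // y A2y; exact: (hM (x, y)).
Qed.

End ParametricIntegral.

Section ConditionalMean.
Context d (T : measurableType d) (R : realType).
Variables (P : probability T R) (A : set T).
Hypotheses (mA : measurable A) (PA : P A = 1%E).
Implicit Types f g w : T -> R.

(* [w] is the indicator, up to null sets, of the conditioning event; the value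
   is [0] when that event is null. *)
Definition cond_mean w g : R :=
  \int[P]_(y in A) (g y * w y) / \int[P]_(y in A) w y.

Lemma cond_meanZ w (c : R) g : bounded_mfun A w -> bounded_mfun A g ->
  cond_mean w (fun y => c * g y) = c * cond_mean w g.
Proof.
move=> bw bg; rewrite /cond_mean mulrA -RintegralZl//.
by under eq_Rintegral do rewrite -mulrA.
Qed.

Lemma cond_meanB w f g : bounded_mfun A w -> bounded_mfun A f ->
  bounded_mfun A g ->
  cond_mean w (fun y => f y - g y) = cond_mean w f - cond_mean w g.
Proof.
move=> bw bf bg; rewrite /cond_mean -mulrBl -RintegralB//.
by under eq_Rintegral do rewrite mulrBl.
Qed.

Lemma ae_eq_cond_mean v w g : bounded_mfun A v -> bounded_mfun A w ->
  bounded_mfun A g -> {ae P, forall y, A y -> v y = w y} ->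
  cond_mean v g = cond_mean w g.
Proof.
move=> bv bw bg vw; congr (_ / _); apply: ae_eq_Rintegral => //;
  [exact: (bounded_mfunM bg bv).1|exact: (bounded_mfunM bg bw).1| |
   exact: bv.1|exact: bw.1].
by apply: filterS vw => y vw /vw ->.
Qed.

Lemma cond_mean_le w g (c : R) : bounded_mfun A w -> bounded_mfun A g ->
  (forall y, A y -> 0 <= w y) -> 0 < \int[P]_(y in A) w y ->
  {ae P, forall y, A y -> w y != 0 -> g y <= c} -> cond_mean w g <= c.
Proof.
move=> bw bg w0 Pw gc; rewrite ler_pdivrMr// -RintegralZl//.
apply: ae_le_Rintegral => //; apply: filterS gc => y gc Ay.
have [->|wy] := eqVneq (w y) 0; first by rewrite !mulr0.
by rewrite ler_wpM2r ?w0 ?gc.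
Qed.

Lemma Rintegral_cond_mean w g : bounded_mfun A w -> bounded_mfun A g ->
  0 < \int[P]_(y in A) w y < 1 ->
  \int[P]_(y in A) g y = cond_mean w g * \int[P]_(y in A) w y +
    cond_mean (fun y => 1 - w y) g * (1 - \int[P]_(y in A) w y).
Proof.
move=> bw bg /andP[w0 w1]; rewrite /cond_mean.
rewrite Rintegral_onem// !divfK ?subr_eq0 ?gt_eqF// -RintegralD//.
by apply: eq_Rintegral => y _; ring.
Qed.

End ConditionalMean.

Lemma bounded_mfun_cond_mean d1 d2 (T1 : measurableType d1)
    (T2 : measurableType d2) (R : realType) (P : probability T2 R)
    (A1 : set T1) (A2 : set T2) (w g : T1 -> T2 -> R) :
  measurable A1 -> measurable A2 ->
  bounded_mfun (A1 `*` A2) (fun p => w p.1 p.2) ->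
  bounded_mfun (A1 `*` A2) (fun p => g p.1 p.2) ->
  (forall x y, A1 x -> A2 y -> 0 <= w x y) ->
  bounded_mfun A1 (fun x => cond_mean P A2 (w x) (g x)).
Proof.
move=> mA1 mA2 bw bg w0; have [_ [M gM]] := bg.
have bI h : bounded_mfun (A1 `*` A2) (fun p => h p.1 p.2) ->
    bounded_mfun A1 (fun x => \int[P]_(y in A2) h x y).
  exact: bounded_mfun_Rintegral.
apply: (@bounded_mfun_div _ _ _ _ _ _ M).
- exact: (bI (fun x y => g x y * w x y) (bounded_mfunM bg bw)).1.
- exact: (bI _ bw).1.
- by move=> x A1x; apply: Rintegral_ge0 => y; exact: w0.
- move=> x A1x; have bwx := bounded_mfun_section mA1 mA2 A1x bw.
  have bgx := bounded_mfun_section mA1 mA2 A1x bg.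
  rewrite -RintegralZl//; apply: normr_le_Rintegral => // y A2y.
  by rewrite normrM [X in _ * X]ger0_norm ?w0// ler_wpM2r ?w0// (gM (x, y)).
Qed.

Section LowerExpectation.
Context d (T : measurableType d) (R : realType).
Variables (A : set T) (C : set (probability T R)).
Hypotheses (mA : measurable A) (C_full : forall Q, C Q -> Q A = 1%E).
Hypothesis C_neq0 : C !=set0.
Implicit Types f g : T -> R.

Definition lower_expectation g : R := inf [set \int[Q]_(y in A) g y | Q in C].

Lemma has_lbound_expectations g : bounded_mfun A g ->
  has_lbound [set \int[Q]_(y in A) g y | Q in C].
Proof.
move=> bg; have [_ [M gM]] := bg; exists (- M) => _ [Q CQ <-].
rewrite lerNl -[leRHS](Rintegral_prob_cst mA (C_full CQ)).
rewrite (le_trans (ler_norm _))// normrN; exact: normr_le_Rintegral.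
Qed.

Lemma lower_expectation_le g Q : bounded_mfun A g -> C Q ->
  lower_expectation g <= \int[Q]_(y in A) g y.
Proof.
by move=> bg CQ; apply: ge_inf; [exact: has_lbound_expectations|exists Q].
Qed.

Lemma le_lower_expectation g (c : R) :
  (forall Q, C Q -> c <= \int[Q]_(y in A) g y) -> c <= lower_expectation g.
Proof.
move=> cg; apply: lb_le_inf; last by move=> _ [Q CQ <-]; exact: cg.
by have [Q CQ] := C_neq0; exists (\int[Q]_(y in A) g y), Q.
Qed.

Lemma lower_expectation01 g : bounded_mfun A g ->
  (forall y, A y -> 0 <= g y <= 1) -> 0 <= lower_expectation g <= 1.
Proof.
move=> bg g01; apply/andP; split.
  by apply: le_lower_expectation => Q CQ; apply: Rintegral_ge0 => y /g01/andP[].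
have [Q CQ] := C_neq0; have intg := probability_bounded_mfun_integrable Q mA bg.
rewrite (le_trans (lower_expectation_le bg CQ))//.
by have /andP[] := Rintegral01 mA (C_full CQ) intg g01.
Qed.

Lemma eq_lower_expectation f g : {in A, f =1 g} ->
  lower_expectation f = lower_expectation g.
Proof.
move=> fg; congr inf; apply: eq_imagel => Q _; exact: eq_Rintegral.
Qed.

Lemma lower_expectationD f g : bounded_mfun A f -> bounded_mfun A g ->
  lower_expectation f + lower_expectation g <=
  lower_expectation (fun y => f y + g y).
Proof.
move=> bf bg; apply: le_lower_expectation => Q CQ.
by rewrite RintegralD// lerD// lower_expectation_le.
Qed.

Lemma lower_expectation_affine_le (c e : R) g : bounded_mfun A g ->
  lower_expectation (fun y => c * g y + e) <= c * lower_expectation g + e.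
Proof.
move=> bg; rewrite -lerBlDr; have [c0|c0] := leP c 0.
  have [Q CQ] := C_neq0; apply: le_trans (_ : c * \int[Q]_(y in A) g y <= _).
    rewrite lerBlDr -Rintegral_affine//; last exact: C_full.
    exact: lower_expectation_le.
  by rewrite ler_wnM2l// lower_expectation_le.
rewrite mulrC -ler_pdivrMr//; apply: le_lower_expectation => Q CQ.
rewrite ler_pdivrMr// mulrC lerBlDr -Rintegral_affine//; last exact: C_full.
exact: lower_expectation_le.
Qed.

Lemma lower_expectation_affine (c e : R) g : 0 <= c -> bounded_mfun A g ->
  lower_expectation (fun y => c * g y + e) = c * lower_expectation g + e.
Proof.
move=> c0 bg; apply/eqP; rewrite eq_le lower_expectation_affine_le//=.
apply: le_lower_expectation => Q CQ.
rewrite Rintegral_affine//; last exact: C_full.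
by rewrite lerD2r ler_wpM2l// lower_expectation_le.
Qed.

End LowerExpectation.

Lemma integral_proportional d (T : measurableType d) (R : realType)
    (mu nu : {measure set T -> \bar R}) (k : {nonneg R}) (A : set T)
    (f : T -> \bar R) : measurable A -> mu.-integrable A f ->
  (forall S, measurable S -> S `<=` A -> nu S = k%:num%:E * mu S)%E ->
  (\int[nu]_(x in A) f x = k%:num%:E * \int[mu]_(x in A) f x)%E.
Proof.
move=> mA intf nuE.
have mf := measurable_int mu intf.
rewrite (eq_measure_integral (mscale k mu))//.
rewrite [LHS]integralE (integralE mu A f) ge0_integral_mscale//; last first.
  exact: measurable_funepos.
rewrite ge0_integral_mscale//; last exact: measurable_funeneg.
rewrite [RHS]muleBr//; apply: fin_num_adde_defr.
exact: integrable_pos_fin_num.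
Qed.

Lemma Rintegral_indic d (T : measurableType d) (R : realType)
    (mu : {measure set T -> \bar R}) (A W : set T) :
  measurable A -> measurable W -> W `<=` A ->
  \int[mu]_(x in A) \1_W x = fine (mu W).
Proof. by move=> mA mW WA; rewrite /Rintegral integral_indic// setIidl. Qed.

Section JeffreyUpdate.
Context d (T : measurableType d) (R : realType).
Variables (A : set T) (s : T -> bool) (P Q : probability T R).
Hypotheses (mA : measurable A) (ms : measurable_fun A s).
Implicit Types S : set T.

Definition cell (c : bool) : set T := A `&` s @^-1` [set c].

Definition jeffrey_weight (c : bool) : {nonneg R} :=
  NngNum (divr_ge0 (fine_ge0 (measure_ge0 Q (cell c)))
                   (fine_ge0 (measure_ge0 P (cell c)))).

(* Jeffrey's rule of conditioning: on [A], the update [Q'] has the law of [s]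
   under [Q] and the conditionals of [P] given [s]. *)
Definition jeffrey_update (Q' : probability T R) : Prop :=
  forall c S, measurable S -> S `<=` cell c ->
  (Q' S = (jeffrey_weight c)%:num%:E * P S)%E.

Lemma measurable_cell c : measurable (cell c).
Proof. exact: ms. Qed.
#[local] Hint Resolve measurable_cell : core.

Lemma cellU S : S `<=` A -> S = (S `&` cell true) `|` (S `&` cell false).
Proof.
move=> SA; apply/seteqP; split=> [y Sy|y [] []//].
by case sy: (s y); [left|right]; do !split => //; exact: SA.
Qed.

Lemma cell_disjoint S : (S `&` cell true) `&` (S `&` cell false) = set0.
Proof.
by apply/seteqP; split=> // y [[_ [_ /= sy]] [_ [_ /=]]]; rewrite sy.
Qed.

Lemma probability_cells (m : probability T R) S : measurable S -> S `<=` A ->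
  (m S = m (S `&` cell true) + m (S `&` cell false))%E.
Proof.
move=> mS SA; rewrite {1}(cellU SA) measureU//; [exact: measurableI..|].
exact: cell_disjoint.
Qed.

Lemma probability_cell_false (m : probability T R) : m A = 1%E ->
  fine (m (cell false)) = 1 - fine (m (cell true)).
Proof.
move=> mA1; have cellA c : A `&` cell c = cell c.
  by apply/setIidr; exact: subIsetl.
have := probability_cells m mA (@subset_refl _ A).
rewrite !cellA mA1 => /(congr1 fine).
have finm c : m (cell c) \is a fin_num by rewrite fin_num_measure.
by rewrite fineD//= => ->; rewrite addrAC subrr add0r.
Qed.

Hypotheses (QA : Q A = 1%E)
  (Pcell : forall c, (0 < P (cell c))%E).

Lemma jeffrey_weightK c :
  ((jeffrey_weight c)%:num%:E * P (cell c) = Q (cell c))%E.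
Proof.
have Pc : 0 < fine (P (cell c)).
  by rewrite fine_gt0// Pcell ltey_eq fin_num_measure.
rewrite -[P _]fineK ?fin_num_measure// -EFinM /= divfK ?gt_eqF// fineK//.
exact: fin_num_measure.
Qed.

Lemma ex_jeffrey_update : exists Q', jeffrey_update Q'.
Proof.
pose piece c : {measure set T -> \bar R} :=
  mscale (jeffrey_weight c) (mrestr P (measurable_cell c)).
pose m : {measure set T -> \bar R} := measure_add (piece true) (piece false).
have mE S : (m S = (jeffrey_weight true)%:num%:E * P (S `&` cell true) +
    (jeffrey_weight false)%:num%:E * P (S `&` cell false))%E.
  exact: measure_addE.
have mT : m setT = 1%E.
  rewrite mE !setTI !jeffrey_weightK -QA (probability_cells Q mA)//.
  by rewrite !setIA setIid.
exists (mnormalize m P) => c S mS Sc.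
rewrite /= /mnormalize mT onee_eq0/= invr1 mule1 -[LHS]/(m S) mE.
have SA : S `<=` A by move=> y /Sc[].
have S0 : S `&` cell (~~ c) = set0.
  by apply/seteqP; split=> // y [/Sc[_ /= sy] [_ /=]]; rewrite sy; case: (c).
by case: c Sc S0 => /= Sc ->; rewrite (setIidl Sc) measure0 mule0 ?adde0 ?add0e.
Qed.

Variable Q' : probability T R.
Hypothesis Q'P : jeffrey_update Q'.

Lemma jeffrey_updateE S : measurable S -> S `<=` A ->
  Q' S = (\int[P]_(y in S) (jeffrey_weight (s y))%:num%:E)%E.
Proof.
move=> mS SA; have mSc c : measurable (S `&` cell c) by exact: measurableI.
rewrite (probability_cells Q' mS SA) [in RHS](cellU SA) ge0_integral_setU//;
  last 2 first.
- rewrite -cellU//; apply/measurable_EFinP.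
  pose weight c : R := (jeffrey_weight c)%:num.
  apply: (measurableT_comp (f := weight)) => //.
  exact: measurable_funS ms.
- by apply/disj_set2P; exact: cell_disjoint.
have cellE c : Q' (S `&` cell c) =
    (\int[P]_(y in S `&` cell c) (jeffrey_weight (s y))%:num%:E)%E.
  rewrite (Q'P (mSc c) (@subIsetr _ _ _)) -integral_cst//.
  by apply: eq_integral => y /set_mem[_ [_ /= ->]].
by rewrite !cellE.
Qed.

Lemma jeffrey_update_statistic (B : set bool) :
  Q' (A `&` s @^-1` B) = Q (A `&` s @^-1` B).
Proof.
set S := _ `&` _; have mS : measurable S by exact: ms.
have cellE c : Q' (S `&` cell c) = Q (S `&` cell c).
  have [Bc|nBc] := pselect (B c).
    have -> : S `&` cell c = cell c.
      by apply/setIidr => y [Ay /= sy]; split => //=; rewrite sy.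
    by rewrite (Q'P (measurable_cell c) (@subset_refl _ _)) jeffrey_weightK.
  rewrite (_ : S `&` cell c = set0) ?measure0//.
  by apply/seteqP; split=> // y [[_ /= By] [_ /= sy]]; apply: nBc; rewrite -sy.
have SA : S `<=` A by exact: subIsetl.
by rewrite (probability_cells Q' mS)// (probability_cells Q mS)// !cellE.
Qed.

Lemma jeffrey_update_full : Q' A = 1%E.
Proof.
by have := jeffrey_update_statistic setT; rewrite preimage_setT setIT QA.
Qed.

Lemma jeffrey_update_Rintegral g : bounded_mfun A g ->
  \int[Q']_(y in A) g y =
    fine (Q (cell true)) * cond_mean P A \1_(cell true) g +
    fine (Q (cell false)) * cond_mean P A \1_(cell false) g.
Proof.
move=> bg; have cellE c : \int[Q']_(y in A `&` cell c) g y =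
    fine (Q (cell c)) * cond_mean P A \1_(cell c) g.
  have mAc : measurable (A `&` cell c) by exact: measurableI.
  have intg : P.-integrable (A `&` cell c) (EFin \o g).
    exact: (integrableS mA) (probability_bounded_mfun_integrable P mA bg).
  rewrite /Rintegral (integral_proportional (k := jeffrey_weight c) mAc intg).
    rewrite fineM//; last exact: integrable_fin_num.
    rewrite -[X in _ * X]/(\int[P]_(y in A `&` cell c) g y) Rintegral_mkcondr.
    rewrite patch_indic /cond_mean Rintegral_indic//=; last exact: subIsetl.
    by rewrite mulrAC mulrA.
  by move=> S mS SAc; apply: Q'P => // y /SAc[].
rewrite -!cellE {1}(cellU (@subset_refl _ A)) Rintegral_setU//.
- exact: measurableI.
- exact: measurableI.
- by rewrite -cellU.
- by apply/disj_set2P; exact: cell_disjoint.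
Qed.

End JeffreyUpdate.

Definition jeffrey_stable d (T : measurableType d) (R : realType) (A : set T)
    (P : probability T R) (C : set (probability T R)) : Prop :=
  forall (s : T -> bool) Q, measurable_fun A s ->
  (forall c, (0 < P (cell A s c))%E) -> C Q ->
  exists2 Q', C Q' & jeffrey_update A s P Q Q'.

Section MonotoneIntegral.
Context (R : realType) (a b : R).
Local Notation mu := (@lebesgue_measure R).
Implicit Types f : R -> R.

Lemma nondecreasing_in_bounded_mfun f : {in `[a, b] &, nondecreasing_fun f} ->
  bounded_mfun (`[a, b]%classic : set R) f.
Proof.
move=> f_nd; have [ab|ba] := leP a b; last first.
  rewrite set_itv_ge ?bnd_simp -?ltNge//.
  by split; [exact: measurable_fun_set0|exists 0].
have clampP z : Num.max a (Num.min z b) \in `[a, b].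
  by rewrite in_itv/= le_max lexx/= ge_max ab ge_min lexx orbT.
split.
  pose clamp z := Num.max a (Num.min z b).
  apply: (eq_measurable_fun (f \o clamp)).
    move=> z; rewrite inE/= in_itv/= => /andP[az zb].
    by rewrite /clamp (min_idPl zb) (max_idPr az).
  apply: nondecreasing_measurable => // z z' zz'.
  by apply: f_nd; rewrite ?clampP// le_max2// le_min2.
exists (Num.max `|f a| `|f b|) => z zab; have := zab.
rewrite /= in_itv/= => /andP[az zb]; rewrite le_max.
have fa : f a <= f z by apply: f_nd => //; rewrite in_itv/= lexx ab.
have fb : f z <= f b by apply: f_nd => //; rewrite in_itv/= lexx ab.
have := ler_norm (f b); have := ler_norm (- f a); rewrite normrN => na nb.
have [fz|fz] := leP 0 (f z); apply/orP; [right|left].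
- by rewrite ger0_norm//; lra.
- by rewrite ltr0_norm//; lra.
Qed.

Lemma nondecreasing_in_integrable f (i : interval R) :
  {in `[a, b] &, nondecreasing_fun f} -> [set` i] `<=` `[a, b] ->
  mu.-integrable [set` i] (EFin \o f).
Proof.
move=> f_nd iab; apply: (@integrableS _ _ _ mu `[a, b]) => //.
apply: bounded_mfun_integrable => //; last exact: nondecreasing_in_bounded_mfun.
by rewrite /= lebesgue_measure_itv/=; case: ifPn; rewrite ltry// -EFinB ltry.
Qed.

Variable f : R -> R.
Hypothesis f_nd : {in `[a, b] &, nondecreasing_fun f}.
Local Notation F := (fun t => \int[mu]_(z in `[a, t]) f z).

Lemma nondecreasing_Rintegral_increment s t :
  s \in `[a, b] -> t \in `[a, b] -> s <= t ->
  (t - s) * f s <= F t - F s <= (t - s) * f t.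
Proof.
move=> sab tab st; have := sab; have := tab; rewrite !in_itv/=.
move=> /andP[a_t tb] /andP[a_s sb].
have sub : `]s, t] `<=` `[a, b]%classic.
  move=> z /=; rewrite !in_itv/= => /andP[sz zt].
  by rewrite (le_trans a_s (ltW sz)) (le_trans zt tb).
have cstE c : (t - s) * c = \int[mu]_(z in `]s, t]) c.
  rewrite Rintegral_cst//= lebesgue_measure_itv/= lte_fin mulrC.
  by case: ltgtP st => //= -> _; rewrite subrr.
have intf : mu.-integrable `]s, t] (EFin \o f).
  exact: nondecreasing_in_integrable.
have intc c : mu.-integrable `]s, t] (EFin \o (fun=> c)).
  exact: nondecreasing_in_integrable.
rewrite Rintegral_itvB//; last first.
  apply: nondecreasing_in_integrable => // z /=; rewrite !in_itv/=.
  by move=> /andP[-> /le_trans]; exact.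
rewrite !cstE; apply/andP; split; apply: le_Rintegral => // z zst.
- apply: f_nd => //; first exact: sub.
  by move: zst; rewrite /= in_itv/= => /andP[/ltW].
- apply: f_nd => //; first exact: sub.
  by move: zst; rewrite /= in_itv/= => /andP[].
Qed.

(* Along a subdivision of step [h], the quantity [U - F + h f] does not
   decrease, where [F] is the integral of [f] from [a]; hence [U - F] loses at
   most [h (f t - f a)] between [a] and [t]. *)
Lemma subgradient_Rintegral_le (U : R -> R) t :
  (forall r s, r \in `[a, b] -> s \in `[a, b] -> r <= s ->
     U r + (s - r) * f r <= U s) ->
  t \in `[a, b] -> U a + F t <= U t.
Proof.
move=> Uf tab; have := tab; rewrite in_itv/= => /andP[a_t tb].
apply/ler_addgt0Pr => e e0; set D := (t - a) * (f t - f a).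
pose n := (Num.truncn (D / e)).+1; pose h := (t - a) / n%:R.
have n_gt0 : 0 < n%:R :> R by rewrite ltr0n.
have h_ge0 : 0 <= h by rewrite divr_ge0 ?subr_ge0// ltW.
have h_small : h * (f t - f a) <= e.
  rewrite /h mulrAC -/D ler_pdivrMr// mulrC -ler_pdivrMr//.
  by apply: ltW; exact: truncnS_gt.
have tE : a + n%:R * h = t by rewrite /h mulrC divfK ?gt_eqF// addrC subrK.
pose p k := a + k%:R * h.
have pS k : p k.+1 - p k = h by rewrite /p -addn1 natrD; ring.
have pab k : (k <= n)%N -> p k \in `[a, b].
  move=> kn; rewrite in_itv/= lerDl mulr_ge0//=; apply: le_trans tb.
  by rewrite -tE lerD2l ler_wpM2r// ler_nat.
have Up k : (k <= n)%N -> U a + h * f a <= U (p k) - F (p k) + h * f (p k).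
  elim: k => [_|k IH kn].
    by rewrite /p mul0r addr0 set_itv1 Rintegral_set1 subr0.
  have pkS : p k <= p k.+1 by rewrite -subr_ge0 pS.
  have := Uf _ _ (pab k (ltnW kn)) (pab _ kn) pkS.
  have := nondecreasing_Rintegral_increment (pab k (ltnW kn)) (pab _ kn) pkS.
  rewrite pS => /andP[_ ?] ?; apply: le_trans (IH (ltnW kn)) _.
  by lra.
have := Up n (leqnn n); rewrite /p tE; lra.
Qed.

End MonotoneIntegral.

Section Bidder.
Context d (Y : measurableType d) (R : realType) (a b : R).
Variables (A : set Y) (C : set (probability Y R)) (P : probability Y R).
Hypotheses (mA : measurable A) (C_full : forall Q, C Q -> Q A = 1%E).
Hypothesis C_ref : C P.
Variable x : R -> Y -> R.
Hypothesis bx : bounded_mfun (`[a, b] `*` A) (fun p => x p.1 p.2).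
Hypothesis x01 : forall th y, th \in `[a, b] -> A y -> 0 <= x th y <= 1.
Implicit Types (t : R -> Y -> R) (th s w l : R) (y : Y).

Let C_neq0 : C !=set0. Proof. by exists P. Qed.

Let mab : measurable (`[a, b]%classic : set R).
Proof. exact: measurable_itv. Qed.

Let left_mem th : th \in `[a, b] -> a \in `[a, b].
Proof. by rewrite !in_itv/= lexx => /andP[]; exact: le_trans. Qed.

Let bounded_mfun_alloc th : th \in `[a, b] -> bounded_mfun A (x th).
Proof. by move=> thab; exact: bounded_mfun_section mab mA _ _ thab bx. Qed.
#[local] Hint Resolve bounded_mfun_alloc : bounded_mfun.

Definition worst_win th : R := lower_expectation A C (x th).

Definition win_prob th : R := \int[P]_(y in A) x th y.

(* The worst-case payoff of a bidder of type [s] who reports [th]. *)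
Definition worst_payoff t s th : R :=
  lower_expectation A C (fun y => s * x th y - t th y).

Definition rent th : R := \int[lebesgue_measure]_(z in `[a, th]) worst_win z.

Lemma worst_win01 th : th \in `[a, b] -> 0 <= worst_win th <= 1.
Proof.
move=> thab; apply: (lower_expectation01 mA C_full) => // y; exact: x01.
Qed.

Lemma win_prob01 th : th \in `[a, b] -> 0 <= win_prob th <= 1.
Proof.
by move=> thab; apply: (Rintegral01 mA (C_full C_ref)) => // y; exact: x01.
Qed.

Lemma win_prob_interior th : th \in `[a, b] ->
  win_prob th != 0 -> win_prob th != 1 -> 0 < win_prob th < 1.
Proof.
by move=> /win_prob01/andP[X0 X1] Xn0 Xn1; rewrite !lt_neqAle Xn1 eq_sym Xn0 X0.
Qed.

Lemma worst_win_le th : th \in `[a, b] -> worst_win th <= win_prob th.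
Proof. by move=> thab; apply: (lower_expectation_le mA C_full). Qed.

Hypothesis worst_win_nd : {in `[a, b] &, nondecreasing_fun worst_win}.

Lemma rent_increment s th : s \in `[a, b] -> th \in `[a, b] -> s <= th ->
  (th - s) * worst_win s <= rent th - rent s <= (th - s) * worst_win th.
Proof. exact: nondecreasing_Rintegral_increment. Qed.

Lemma rent_left : rent a = 0.
Proof. by rewrite /rent set_itv1 Rintegral_set1. Qed.

Lemma rent_nondecreasing : {in `[a, b] &, nondecreasing_fun rent}.
Proof.
move=> s th sab thab sth; rewrite -subr_ge0.
have /andP[+ _] := rent_increment sab thab sth; apply: le_trans.
by have /andP[m0 _] := worst_win01 sab; rewrite mulr_ge0// subr_ge0.
Qed.

Lemma rent_bounds th : th \in `[a, b] ->
  0 <= rent th <= (th - a) * worst_win th.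
Proof.
move=> thab; have aab := left_mem thab.
have ath : a <= th by move: thab; rewrite in_itv/= => /andP[].
have /andP[_] := rent_increment aab thab ath; rewrite rent_left subr0 => ->.
by rewrite -rent_left rent_nondecreasing.
Qed.

Lemma null_win th : th \in `[a, b] -> win_prob th = 0 ->
  worst_win th = 0 /\ rent th = 0.
Proof.
move=> thab X0; have /andP[m0 _] := worst_win01 thab.
have m_le0 := worst_win_le thab; rewrite X0 in m_le0.
have m_eq0 : worst_win th = 0 by apply/eqP; rewrite eq_le m_le0.
have := rent_bounds thab; rewrite m_eq0 mulr0 => /andP[V0 V_le0].
by split=> //; apply/eqP; rewrite eq_le V_le0.
Qed.

Lemma worst_payoff_win_loseE t w l s th :
  (forall y, A y -> t th y = w * x th y + l * (1 - x th y)) ->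
  worst_payoff t s th =
  lower_expectation A C (fun y => (s - w + l) * x th y + - l).
Proof.
by move=> tE; apply: eq_lower_expectation => y /set_mem Ay; rewrite tE//; ring.
Qed.

(* The payoff from a report is affine in the true type with slope [worst_win],
   or lies below that line if winning becomes worse than losing. *)
Lemma win_lose_payoff_le t w l s th :
  s \in `[a, b] -> th \in `[a, b] ->
  (forall y, A y -> t th y = w * x th y + l * (1 - x th y)) ->
  - l <= th - w -> worst_payoff t th th = rent th ->
  worst_payoff t s th <= rent s.
Proof.
move=> sab thab tE wl; have bxth := bounded_mfun_alloc thab.
rewrite !(worst_payoff_win_loseE _ tE).
rewrite (lower_expectation_affine mA C_full C_neq0)//; last lra.
have := lower_expectation_affine_le mA C_full C_neq0 (s - w + l) (- l) bxth.
rewrite -/(worst_win th) => + rentE; move=> /le_trans; apply.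
have -> : (s - w + l) * worst_win th - l = rent th + (s - th) * worst_win th.
  by rewrite -rentE; ring.
have [ths|/ltW sth] := leP th s.
- by have /andP[+ _] := rent_increment thab sab ths; lra.
- by have /andP[_] := rent_increment sab thab sth; lra.
Qed.

Definition wins th y : bool := x th y == 1.

Definition outcome th (c : bool) y : R := if c then x th y else 1 - x th y.

Definition almost_binary th : Prop :=
  {ae P, forall y, A y -> x th y = 0 \/ x th y = 1}.

Let bounded_mfun_outcome th c :
  th \in `[a, b] -> bounded_mfun A (outcome th c).
Proof. by move=> thab; case: c; rewrite /outcome. Qed.
#[local] Hint Resolve bounded_mfun_outcome : bounded_mfun.

Lemma outcome_ge0 th c y : th \in `[a, b] -> A y -> 0 <= outcome th c y.
Proof.
by move=> thab Ay; have /andP[] := x01 thab Ay; case: c; rewrite /= ?subr_ge0.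
Qed.

Lemma Rintegral_outcome th c : th \in `[a, b] ->
  \int[P]_(y in A) outcome th c y =
  if c then win_prob th else 1 - win_prob th.
Proof.
by move=> thab; case: c => //; rewrite (Rintegral_onem mA (C_full C_ref)).
Qed.

Lemma measurable_wins th : th \in `[a, b] -> measurable_fun A (wins th).
Proof.
move=> thab; apply: measurable_fun_eqr => //.
exact: (bounded_mfun_alloc thab).1.
Qed.

Section InteriorType.
Variable th : R.
Hypotheses (thab : th \in `[a, b]) (th_interior : 0 < win_prob th < 1).
Hypothesis th_binary : almost_binary th.

Let mcell c : measurable (cell A (wins th) c).
Proof. by apply: measurable_cell => //; exact: measurable_wins. Qed.

Let bounded_mfun_cell c : bounded_mfun A (\1_(cell A (wins th) c) : Y -> R).
Proof. exact: bounded_mfun_indic. Qed.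

Lemma indic_wins_cell c :
  {ae P, forall y, A y -> \1_(cell A (wins th) c) y = outcome th c y}.
Proof.
apply: filterS th_binary => y xy Ay; rewrite indicE.
have -> : (y \in cell A (wins th) c) = (wins th y == c).
  by apply/idP/eqP => [/set_mem[]//|wc]; apply: mem_set.
rewrite /wins /outcome; case: (xy Ay) => ->.
  by rewrite [0 == 1]eq_sym oner_eq0; case: c; rewrite ?subr0.
by rewrite eqxx; case: c; rewrite ?subrr.
Qed.

Lemma wins_cell_gt0 c : (0 < P (cell A (wins th) c))%E.
Proof.
rewrite -[P _]fineK ?fin_num_measure// lte_fin.
rewrite -(Rintegral_indic P mA (mcell c)); last exact: subIsetl.
rewrite (ae_eq_Rintegral mA (bounded_mfun_cell c).1
  (bounded_mfun_outcome c thab).1 (indic_wins_cell c)).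
rewrite Rintegral_outcome//.
by have /andP[X0 X1] := th_interior; case: c; rewrite ?subr_gt0.
Qed.

Lemma cond_mean_alloc c : cond_mean P A (outcome th c) (x th) = c%:R.
Proof.
have bxth := bounded_mfun_alloc thab.
have bprod : bounded_mfun A (fun y => x th y * outcome th c y) by [].
rewrite /cond_mean (@ae_eq_Rintegral _ _ _ _ _ mA _ (fun y => c%:R * x th y)).
- rewrite RintegralZl// Rintegral_outcome// -/(win_prob th).
  case: c {bprod} => /=.
    by rewrite mul1r divff// gt_eqF//; have /andP[] := th_interior.
  by rewrite !mul0r.
- exact: bprod.1.
- by apply: measurable_funM => //; exact: bxth.1.
- apply: filterS th_binary => y xy /xy[] xE; rewrite /outcome xE.
    by rewrite mul0r mulr0.
  by rewrite mul1r mulr1; case: c {bprod}; rewrite ?subrr.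
Qed.

End InteriorType.

Section FeasibleTransfer.
Variable t : R -> Y -> R.
Hypothesis bt : bounded_mfun (`[a, b] `*` A) (fun p => t p.1 p.2).
Hypothesis t_ic : forall s th, s \in `[a, b] -> th \in `[a, b] ->
  worst_payoff t s th <= worst_payoff t s s.
Hypothesis t_ir : forall th, th \in `[a, b] -> 0 <= worst_payoff t th th.

Let bounded_mfun_transfer th : th \in `[a, b] -> bounded_mfun A (t th).
Proof. by move=> thab; exact: bounded_mfun_section mab mA _ _ thab bt. Qed.
#[local] Hint Resolve bounded_mfun_transfer : bounded_mfun.

(* Superadditivity of the lower expectation makes [worst_win] a subgradient of
   the utility. *)
Lemma rent_le_payoff th : th \in `[a, b] -> rent th <= worst_payoff t th th.
Proof.
move=> thab; have aab := left_mem thab.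
have subgradient r s : r \in `[a, b] -> s \in `[a, b] -> r <= s ->
    worst_payoff t r r + (s - r) * worst_win r <= worst_payoff t s s.
  move=> rab sab rs; apply: le_trans (t_ic sab rab).
  have -> : (s - r) * worst_win r =
      lower_expectation A C (fun y => (s - r) * x r y + 0).
    by rewrite (lower_expectation_affine mA C_full C_neq0) ?addr0 ?subr_ge0.
  have -> : worst_payoff t s r = lower_expectation A C
      (fun y => (r * x r y - t r y) + ((s - r) * x r y + 0)).
    by apply: eq_lower_expectation => y _; ring.
  exact: (lower_expectationD mA C_full C_neq0).
apply: le_trans (subgradient_Rintegral_le worst_win_nd subgradient thab).
by rewrite lerDr t_ir.
Qed.

Lemma rent_le_mean_payoff th : th \in `[a, b] ->
  rent th <= th * win_prob th - \int[P]_(y in A) t th y.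
Proof.
move=> thab; apply: le_trans (rent_le_payoff thab) _.
apply: le_trans (lower_expectation_le mA C_full _ C_ref) _ => //.
by rewrite RintegralB// RintegralZl.
Qed.

Definition mean_win th : R := cond_mean P A (outcome th true) (t th).
Definition mean_lose th : R := cond_mean P A (outcome th false) (t th).
Definition premium th : R := th - mean_win th + mean_lose th.

Lemma mean_payE th : th \in `[a, b] -> 0 < win_prob th < 1 ->
  \int[P]_(y in A) t th y =
  mean_win th * win_prob th + mean_lose th * (1 - win_prob th).
Proof. by move=> thab X01; exact: (Rintegral_cond_mean mA (C_full C_ref)). Qed.

Lemma mean_pay_class (alpha beta K : R) th :
  th \in `[a, b] -> 0 < win_prob th < 1 -> almost_binary th -> 0 <= alpha ->
  (forall y z, A y -> A z -> x th y = 1 -> x th z = 0 ->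
    alpha * t th y - beta * t th z <= K) ->
  alpha * mean_win th - beta * mean_lose th <= K.
Proof.
move=> thab /andP[X0 X1] th_binary alpha0 tK.
have outcome_gt0 c : 0 < \int[P]_(y in A) outcome th c y.
  by rewrite Rintegral_outcome//; case: c; rewrite ?subr_gt0.
have win_le z : A z -> x th z = 0 -> alpha * mean_win th <= K + beta * t th z.
  move=> Az xz; rewrite -(cond_meanZ P mA)//; apply: (cond_mean_le mA) => //.
    by move=> y; exact: outcome_ge0.
  apply: filterS th_binary => y xy Ay; rewrite /outcome; case: (xy Ay) => xE.
    by rewrite xE eqxx.
  by have := tK y z Ay Az xE xz; lra.
have : - beta * mean_lose th <= K - alpha * mean_win th.
  rewrite -(cond_meanZ P mA)//; apply: (cond_mean_le mA) => //.
    by move=> y; exact: outcome_ge0.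
  apply: filterS th_binary => y xy Ay; rewrite /outcome; case: (xy Ay) => xE.
    by have := win_le y Ay xE; lra.
  by rewrite xE subrr eqxx.
by lra.
Qed.

Lemma updated_payoff (Q Q' : probability Y R) th :
  th \in `[a, b] -> 0 < win_prob th < 1 -> almost_binary th ->
  Q A = 1%E -> jeffrey_update A (wins th) P Q Q' ->
  \int[Q']_(y in A) (th * x th y - t th y) =
  premium th * fine (Q (cell A (wins th) true)) - mean_lose th.
Proof.
move=> thab X01 th_binary QA Q'Q; have mw := measurable_wins thab.
have bpay : bounded_mfun A (fun y => th * x th y - t th y) by [].
have condE c :
    cond_mean P A \1_(cell A (wins th) c) (fun y => th * x th y - t th y) =
    th * c%:R - cond_mean P A (outcome th c) (t th).
  have mc := measurable_cell mA mw c.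
  rewrite (ae_eq_cond_mean mA _ _ bpay (indic_wins_cell th_binary c))//.
  by rewrite cond_meanB// cond_meanZ// cond_mean_alloc.
rewrite (jeffrey_update_Rintegral mA mw Q'Q bpay) !condE.
rewrite (probability_cell_false mA mw QA).
by rewrite /premium /mean_win /mean_lose /=; ring.
Qed.

(* Under the update of [P] by any plausible [Q], the original payments are
   worth what their conditional means are worth under [Q]. *)
Lemma rent_le_mean_insured th :
  th \in `[a, b] -> 0 < win_prob th < 1 -> almost_binary th ->
  jeffrey_stable A P C -> 0 <= premium th ->
  rent th <= premium th * worst_win th - mean_lose th.
Proof.
move=> thab X01 th_binary C_stable premium0.
rewrite -(lower_expectation_affine mA C_full C_neq0)//.
apply: (le_lower_expectation C_neq0) => Q CQ.
rewrite (Rintegral_affine mA (C_full CQ))//.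
have mw := measurable_wins thab; have mwin := measurable_cell mA mw true.
have [Q' CQ' Q'Q] := C_stable _ _ mw (wins_cell_gt0 thab X01 th_binary) CQ.
apply: le_trans (rent_le_payoff thab) _.
apply: le_trans (lower_expectation_le mA C_full _ CQ') _ => //.
rewrite (updated_payoff thab X01 th_binary (C_full CQ) Q'Q).
rewrite lerD2r ler_wpM2l// -(Rintegral_indic Q mA mwin); last exact: subIsetl.
apply: le_Rintegral => // y Ay; rewrite indicE.
have [/set_mem[_ /= /eqP ->]//|_] := boolP (y \in cell A (wins th) true).
by have /andP[] := x01 thab Ay.
Qed.

(* The margin of winning over losing under the insured payments is the premium,
   cut to [0] (full insurance) when losing was better. If winning is null, the
   value [th] makes both insured payments vanish. *)
Definition spread th : R :=
  if win_prob th == 0 then th else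
  if win_prob th == 1 then 0 else Num.max 0 (premium th).

Definition insured_win th : R :=
  th - rent th - spread th * (1 - worst_win th).
Definition insured_lose th : R := spread th * worst_win th - rent th.
Definition insured th y : R :=
  insured_win th * x th y + insured_lose th * (1 - x th y).

Lemma insured_spread th : th - insured_win th + insured_lose th = spread th.
Proof. by rewrite /insured_win /insured_lose; ring. Qed.

Lemma spread_ge0 th : 0 <= th -> 0 <= spread th.
Proof.
by move=> th0; rewrite /spread; do 2!case: ifP => // _; rewrite le_max lexx.
Qed.

Lemma spread_interior th : 0 < win_prob th < 1 ->
  spread th = Num.max 0 (premium th).
Proof. by move=> /andP[X0 X1]; rewrite /spread (gt_eqF X0) (lt_eqF X1). Qed.

Lemma worst_payoff_insured th : 0 <= th -> th \in `[a, b] ->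
  worst_payoff insured th th = rent th.
Proof.
move=> th0 thab; rewrite (worst_payoff_win_loseE th (fun y _ => erefl)).
have spread0 := spread_ge0 th0.
rewrite insured_spread (lower_expectation_affine mA C_full C_neq0)//.
by rewrite -/(worst_win th) /insured_lose; ring.
Qed.

Lemma mean_pay_insured th : th \in `[a, b] ->
  \int[P]_(y in A) insured th y =
  th * win_prob th - rent th - spread th * (win_prob th - worst_win th).
Proof.
move=> thab; rewrite (@eq_Rintegral _ _ _ _ _ (fun y =>
    (insured_win th - insured_lose th) * x th y + insured_lose th)); last first.
  by move=> y _; rewrite /insured; ring.
rewrite (Rintegral_affine mA (C_full C_ref))//.
by rewrite -/(win_prob th) /insured_win /insured_lose; ring.
Qed.

Section BoundedInsurance.

Let bounded_mfun_worst_win : bounded_mfun `[a, b]%classic worst_win.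
Proof. exact: nondecreasing_in_bounded_mfun. Qed.

Let bounded_mfun_rent : bounded_mfun `[a, b]%classic rent.
Proof. exact: nondecreasing_in_bounded_mfun rent_nondecreasing. Qed.

Let bounded_mfun_id : bounded_mfun `[a, b]%classic (fun th : R => th).
Proof. by apply: nondecreasing_in_bounded_mfun => r s. Qed.

Let bounded_mfun_win_prob : bounded_mfun `[a, b]%classic win_prob.
Proof. exact: (bounded_mfun_Rintegral mab mA P bx). Qed.

#[local] Hint Resolve bounded_mfun_worst_win bounded_mfun_rent bounded_mfun_id
  bounded_mfun_win_prob : bounded_mfun.

Lemma bounded_mfun_premium : bounded_mfun `[a, b]%classic premium.
Proof.
have bmean c : bounded_mfun `[a, b]%classic
    (fun th => cond_mean P A (outcome th c) (t th)).
  apply: (bounded_mfun_cond_mean P mab mA _ bt) => [|th y].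
    by case: c; rewrite /outcome.
  exact: outcome_ge0.
have bwin := bmean true; have blose := bmean false.
by rewrite /premium.
Qed.

Lemma bounded_mfun_spread : bounded_mfun `[a, b]%classic spread.
Proof.
have bpremium := bounded_mfun_premium.
have meq c : measurable_fun `[a, b]%classic (fun th => win_prob th == c).
  by apply: measurable_fun_eqr => //; exact: bounded_mfun_win_prob.1.
apply: bounded_mfun_if => //; apply: bounded_mfun_if => //.
exact: bounded_mfun_max.
Qed.

Lemma bounded_mfun_insured_win : bounded_mfun `[a, b]%classic insured_win.
Proof. by have bspread := bounded_mfun_spread; rewrite /insured_win. Qed.

Lemma bounded_mfun_insured_lose : bounded_mfun `[a, b]%classic insured_lose.
Proof. by have bspread := bounded_mfun_spread; rewrite /insured_lose. Qed.

End BoundedInsurance.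

Hypothesis C_stable : jeffrey_stable A P C.
Hypothesis x_binary : forall th, th \in `[a, b] -> almost_binary th.

Lemma mean_lose_le_insured th : th \in `[a, b] -> 0 < win_prob th < 1 ->
  mean_lose th <= insured_lose th.
Proof.
move=> thab X01; rewrite /insured_lose spread_interior//.
have [premium0|premium0] := ltP 0 (premium th).
  have := rent_le_mean_insured thab X01 (x_binary thab) C_stable (ltW premium0).
  by lra.
have := rent_le_mean_payoff thab; rewrite (mean_payE thab X01).
have : premium th * win_prob th <= 0.
  by have /andP[X0 _] := X01; rewrite pmulr_lle0.
by rewrite /premium; lra.
Qed.

Lemma mean_pay_le_insured th : th \in `[a, b] ->
  \int[P]_(y in A) t th y <= \int[P]_(y in A) insured th y.
Proof.
move=> thab; rewrite mean_pay_insured//; have mean := rent_le_mean_payoff thab.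
have [X0|X0] := eqVneq (win_prob th) 0.
  have [m0 V0] := null_win thab X0.
  by move: mean; rewrite X0 m0 V0; lra.
have [X1|X1] := eqVneq (win_prob th) 1.
  by move: mean; rewrite /spread X1 oner_eq0 eqxx; lra.
have X01 := win_prob_interior thab X0 X1.
have := mean_lose_le_insured thab X01; rewrite /insured_lose spread_interior//.
have [premium0|premium0] := ltP 0 (premium th); last by rewrite mul0r; lra.
by rewrite (mean_payE thab X01) /premium; lra.
Qed.

(* Insurance raises both conditional mean payments, the losing one by more. *)
Lemma insured_class (alpha beta K : R) th : th \in `[a, b] ->
  win_prob th != 1 -> 0 <= alpha -> alpha <= beta -> 0 <= K ->
  (forall y z, A y -> A z -> x th y = 1 -> x th z = 0 ->
    alpha * t th y - beta * t th z <= K) ->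
  alpha * insured_win th - beta * insured_lose th <= K.
Proof.
move=> thab X1 alpha0 alpha_beta K0 tK.
have [X0|X0] := eqVneq (win_prob th) 0.
  have [m0 V0] := null_win thab X0.
  rewrite /insured_win /insured_lose /spread X0 eqxx m0 V0.
  by rewrite [leLHS](_ : _ = 0)//; ring.
have X01 := win_prob_interior thab X0 X1.
have mean_le := mean_pay_class thab X01 (x_binary thab) alpha0 tK.
have lose_le := mean_lose_le_insured thab X01.
have win_lose_le :
    insured_win th - mean_win th <= insured_lose th - mean_lose th.
  have : premium th <= spread th by rewrite spread_interior// le_max lexx orbT.
  by rewrite -insured_spread /premium; lra.
have : 0 <= (beta - alpha) * (insured_lose th - mean_lose th).
  by rewrite mulr_ge0 ?subr_ge0.
by have := ler_wpM2l alpha0 win_lose_le; lra.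
Qed.

End FeasibleTransfer.
End Bidder.

Section TypeSpace.
Context {R : realType} (a b : R).
Local Notation Th := (Theta a b).
Local Notation T := (gsT (BorelTheta a b)).

Lemma sub_sigma_BorelTheta : sub_sigma a b (BorelTheta a b).
Proof.
have mTh : measurable Th by exact: measurable_itv.
split=> [|S []//|//]; split; first by split => //; exact: sub0set.
- move=> S [_ mS]; split; first by move=> y [].
  exact: measurableD.
- move=> F FB; split; first by move=> y [n _ Fy]; exact: (FB n).1 Fy.
  by apply: bigcup_measurable => n _; exact: (FB n).2.
Qed.

Lemma BorelTheta_gsT_measurable (S : set R) :
  BorelTheta a b S -> measurable (S : set T).
Proof. by move=> BS; apply: sub_sigma_algebra. Qed.

Lemma gsT_measurable_BorelTheta (S : set R) :
  measurable (S : set T) -> S `<=` Th -> BorelTheta a b S.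
Proof.
move=> mS STh; split=> //; apply: (smallest_sub _ _ mS) => [|? []//].
exact: sigma_algebra_measurable.
Qed.

Lemma measurable_Theta : measurable (Th : set T).
Proof.
by apply: BorelTheta_gsT_measurable; split => //; exact: measurable_itv.
Qed.

Lemma measurable_Theta_id : measurable_fun (Th : set T) (id : T -> R).
Proof.
move=> _ Y mY; apply: BorelTheta_gsT_measurable; split; first exact: subIsetl.
by apply: measurableI => //; exact: measurable_itv.
Qed.

Lemma bounded_mfun_Theta (g : R -> R) :
  bounded_mfun (Th : set R) g -> bounded_mfun (Th : set T) (g : T -> R).
Proof.
apply: (bounded_mfun_comp _ measurable_Theta_id); first exact: measurable_itv.
by move=> _ [y Thy <-].
Qed.

Lemma bounded_mfun_ThetaX (h : R -> R -> R) : bounded_measurable a b h ->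
  bounded_mfun (Th `*` Th : set (R * T)) (fun p => h p.1 p.2).
Proof.
move=> [mh [M hM]]; split; last by exists M => p [Th1 Th2]; exact: hM.
pose r : T -> R := id \_ (Th : set T).
have rE y : Th y -> r y = y by move=> Thy; rewrite /r patchE mem_set.
have mr : measurable_fun setT r.
  exact: (measurable_restrictT _ measurable_Theta).1 measurable_Theta_id.
apply: (eq_measurable_fun ((fun p : R * R => h p.1 p.2) \o
    (fun p : R * T => (p.1, r p.2)))).
  by move=> p /set_mem[_ Thp]; rewrite /= rE.
apply: (measurable_comp (F := Th `*` Th : set (R * R)) _ _ mh).
- by apply: measurableX; exact: measurable_itv.
- by move=> _ [p [Th1 Th2] <-]; split => //=; rewrite rE.
- apply: measurable_funTS; apply: measurable_fun_pair.
    exact: measurable_fst.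
  exact: measurableT_comp mr measurable_snd.
Qed.

Lemma bounded_measurableE (h : R -> R -> R) : bounded_measurable a b h <->
  bounded_mfun (Th `*` Th : set (R * R)) (fun p => h p.1 p.2).
Proof.
split=> -[mh [M hM]]; split=> //; exists M.
  by move=> p [Th1 Th2]; exact: hM.
by move=> th y Thth Thy; exact: (hM (th, y)).
Qed.

Lemma bounded_measurable_section (h : R -> R -> R) th :
  bounded_measurable a b h -> Th th -> bounded_mfun (Th : set R) (h th).
Proof.
have mTh : measurable (Th : set R) by exact: measurable_itv.
move=> /bounded_measurableE bh Thth.
exact: bounded_mfun_section bh.
Qed.

Lemma atomless_ae_neq (P : probability T R) th : atomless P -> Th th ->
  {ae P, forall y : T, y != th :> R}.
Proof.
move=> Pat Thth; have m1 : measurable ([set th] : set T).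
  apply: BorelTheta_gsT_measurable; split; first by move=> _ ->.
  exact: measurable_set1.
exists [set th]; split => //; last by move=> y /= /negP; rewrite negbK => /eqP.
apply/eqP; rewrite eq_le measure_ge0 andbT leNgt; apply/negP => Pth.
have [S [mS Sth]] := Pat _ m1 Pth.
by have [->|->] := subset_set1 Sth; rewrite ?measure0 ltxx ?andbF.
Qed.

End TypeSpace.

Section Plausible.
Context {R : realType} (a b : R).
Local Notation Th := (Theta a b).
Local Notation T := (gsT (BorelTheta a b)).
Variables (D : @divergence R) (P : probability T R) (eta : R).
Hypotheses (hD : assumptionD a b D) (hP : isProbTheta a b P) (heta : 0 < eta).
Implicit Types Q : probability T R.

Definition plausible : set (probability T R) :=
  [set Q | isProbTheta a b Q /\ (Dv D (BorelTheta a b) Q P <= eta%:E)%E].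

Lemma plausible_ref : plausible P.
Proof.
split=> //; have [_ [D1 _ _ _ _]] := hD (sub_sigma_BorelTheta a b) hP hP.
by rewrite D1// lee_fin ltW.
Qed.

Lemma plausible_full Q : plausible Q -> Q (Th : set T) = 1%E.
Proof. by case. Qed.

Lemma worst_caseE (g : R -> R) : bounded_mfun (Th : set R) g ->
  worst_case D P eta g = (lower_expectation (Th : set T) plausible g)%:E.
Proof.
move=> /bounded_mfun_Theta bg; have mTh := @measurable_Theta R a b.
rewrite -ereal_inf_EFin; last 2 first.
- exact: (has_lbound_expectations mTh plausible_full bg).
- by exists (\int[P]_(y in (Th : set T)) g y), P => //; exact: plausible_ref.
congr ereal_inf; apply/seteqP; split=> [_ [Q [QT QD ->]]|_ [_ [Q CQ <-] <-]].
  exists (\int[Q]_(y in (Th : set T)) g y); first by exists Q.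
  exact: EFin_Rintegral.
by have [QT QD] := CQ; exists Q; rewrite EFin_Rintegral.
Qed.

(* By (D5) and (D4), [D(Q' || P) = D(Q'_E || P_E) = D(Q_E || P_E) <= D(Q || P)]
   when [E] is sufficient for the pair [Q', P]. *)
Lemma divergence_sufficient_le E Q Q' (f : R -> R) : sub_sigma a b E ->
  isProbTheta a b Q -> isProbTheta a b Q' ->
  (forall S, E S -> Q' S = Q S) ->
  (forall Y, measurable Y -> E (Th `&` f @^-1` Y)) ->
  (forall S, BorelTheta a b S ->
    Q' S = (\int[P]_(y in (S : set T)) (f y)%:E)%E) ->
  (Dv D (BorelTheta a b) Q' P <= Dv D (BorelTheta a b) Q P)%E.
Proof.
move=> sE QT Q'T QQ' mf Q'f; have [_ _ EB] := sE.
have [_ [_ _ _ D4 _]] := hD (sub_sigma_BorelTheta a b) hP QT.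
have [_ [_ _ _ _ D5]] := hD (sub_sigma_BorelTheta a b) hP Q'T.
rewrite -(D5 E)//.
- rewrite (_ : Dv D E Q' P = Dv D E Q P); first exact: D4.
  rewrite /Dv; congr D; apply/funext => S; rewrite /Defs.restrict.
  by case: asboolP => // /QQ'.
- exists f, f; split; last exact: (@aeW _ T R P (fun y => Th y -> f y = f y)).
  + by split=> [_ Y /mf|S /EB /Q'f//]; exact: sub_sigma_algebra.
  + by split=> // _ Y /mf/EB; exact: sub_sigma_algebra.
Qed.

Lemma plausible_jeffrey_stable : jeffrey_stable (Th : set T) P plausible.
Proof.
move=> s Q ms Pcell [QT QD]; have mTh := @measurable_Theta R a b.
have [Q' Q'Q] := ex_jeffrey_update mTh ms QT Pcell.
exists Q' => //; have Q'T := jeffrey_update_full mTh ms QT Pcell Q'Q.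
split=> //; apply: le_trans QD.
pose E := preimage_set_system Th s setT.
have EB : E `<=` BorelTheta a b.
  move=> _ [B _ <-]; apply: gsT_measurable_BorelTheta; last exact: subIsetl.
  exact: ms.
pose weight c : R := (jeffrey_weight (Th : set T) s P Q c)%:num.
apply: (@divergence_sufficient_le E _ _ (weight \o s)) => //.
- split; last exact: EB.
    by apply: sigma_algebra_preimage; split.
  by move=> S /EB[].
- by move=> _ [B _ <-]; exact: jeffrey_update_statistic Q'Q B.
- by move=> Y _; exists (weight @^-1` Y).
- move=> S BS; have [STh _] := BS.
  exact: (jeffrey_updateE mTh ms Q'Q (BorelTheta_gsT_measurable BS) STh).
Qed.

End Plausible.

Section Auction.
Context {R : realType} (a b : R).
Hypothesis hab : 0 < a < b.
Local Notation Th := (Theta a b).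
Local Notation T := (gsT (BorelTheta a b)).
Variables (D : @divergence R) (P : probability T R) (eta : R).
Hypotheses (hD : assumptionD a b D) (hP : isProbTheta a b P).
Hypotheses (hPat : atomless P) (heta : 0 < eta).
Variable x : 'I_2 -> R -> R -> R.
Hypotheses (hx : allocation_rule a b x) (hX : assumptionX D P eta x).
Variables alpha beta K : R.
Implicit Types (t : 'I_2 -> R -> R -> R) (i : 'I_2) (th s : R).

Local Notation C := (plausible D P eta).
Local Notation bidder_win i := (worst_win (Th : set T) C (x i)).
Local Notation bidder_payoff t i := (worst_payoff (Th : set T) C (x i) (t i)).
Local Notation bidder_rent i := (rent a (Th : set T) C (x i)).

Let mTh : measurable (Th : set T). Proof. exact: measurable_Theta. Qed.

Let C_ref : C P. Proof. exact: plausible_ref. Qed.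

Let C_full Q : C Q -> Q (Th : set T) = 1%E. Proof. exact: plausible_full. Qed.

Let bx i : bounded_mfun (Th `*` Th : set (R * T)) (fun p => x i p.1 p.2).
Proof. by apply: bounded_mfun_ThetaX; exact: hx.1. Qed.

Let x01 i th y : th \in `[a, b] -> Th y -> 0 <= x i th y <= 1.
Proof.
move=> thab Thy; have [_ x_feasible] := hx.
have [->|->] : i = bidder1 \/ i = bidder2.
  by case: i => -[|[|//]] ?; [left|right]; exact: val_inj.
- by have [x1 x2 x12] := x_feasible _ _ thab Thy; rewrite x1/=; lra.
- by have [x1 x2 x12] := x_feasible _ _ Thy thab; rewrite x2/=; lra.
Qed.

Lemma XminE i th : Th th -> Xmin D P eta x i th = (bidder_win i th)%:E.
Proof.
move=> Thth; apply: worst_caseE => //.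
by apply: bounded_measurable_section Thth; exact: hx.1.
Qed.

Let worst_win_nd i : {in `[a, b] &, nondecreasing_fun (bidder_win i)}.
Proof.
move=> s th sab thab sth; have [_ _ Xmin_nd] := hX.
by rewrite -lee_fin -!XminE//; exact: Xmin_nd.
Qed.

Lemma integral_XminE i th : Th th ->
  (\int[lebesgue_measure]_(z in `[a, th]) Xmin D P eta x i z)%E =
  (bidder_rent i th)%:E.
Proof.
rewrite /Theta /= in_itv/= => /andP[ath thb].
have thsub : `[a, th] `<=` `[a, b]%classic.
  by move=> z /=; rewrite !in_itv/= => /andP[-> /le_trans]; exact.
have int_win := nondecreasing_in_integrable (worst_win_nd i) thsub.
rewrite EFin_Rintegral//.
by apply: eq_integral => z /set_mem /thsub; exact: XminE.
Qed.

Lemma UrepE t i s th : transfer_rule a b t -> Th th ->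
  Urep D P eta x t i s th = (bidder_payoff t i s th)%:E.
Proof.
move=> bt Thth; apply: worst_caseE => //.
have bxth := bounded_measurable_section (hx.1 i) Thth.
by have btth := bounded_measurable_section (bt i) Thth.
Qed.

Lemma TexpE t i th : transfer_rule a b t -> Th th ->
  Texp P t i th = (\int[P]_(y in (Th : set T)) t i th y)%:E.
Proof.
move=> bt Thth.
have btth := bounded_mfun_Theta (bounded_measurable_section (bt i) Thth).
by rewrite EFin_Rintegral.
Qed.

Lemma revenue_le t t' : transfer_rule a b t -> transfer_rule a b t' ->
  (forall i th, Th th -> \int[P]_(y in (Th : set T)) t i th y <=
    \int[P]_(y in (Th : set T)) t' i th y) ->
  (revenue P t <= revenue P t')%E.
Proof.
move=> bt bt' tt'; apply: lee_sum => i _.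
have bmean u : transfer_rule a b u ->
    bounded_mfun (Th : set T) (fun th => \int[P]_(y in (Th : set T)) u i th y).
  move=> bu; apply: bounded_mfun_Theta.
  apply: (bounded_mfun_Rintegral (measurable_itv _) mTh P).
  exact: bounded_mfun_ThetaX.
have meanE u : transfer_rule a b u ->
    (\int[P]_(th in (Th : set T)) Texp P u i th =
    (\int[P]_(th in (Th : set T)) \int[P]_(y in (Th : set T)) u i th y)%:E)%E.
  move=> bu; have bm := bmean u bu.
  rewrite EFin_Rintegral//.
  by apply: eq_integral => th /set_mem Thth; exact: TexpE.
have bm := bmean _ bt; have bm' := bmean _ bt'.
by rewrite !meanE// lee_fin; apply: le_Rintegral => // th; exact: tt'.
Qed.

Lemma admissibleR_admissibleP t : admissibleR D P eta alpha beta K x t ->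
  admissibleP D P eta alpha beta K x t.
Proof.
move=> [bt [w [l wl]] UV tT]; split=> //.
have payoffE i th : Th th -> bidder_payoff t i th th = bidder_rent i th.
  by move=> Thth; apply: EFin_inj; rewrite -integral_XminE// -UV// /Umin UrepE.
split=> [i th th' Thth Thth'|i th Thth].
  rewrite !UrepE// lee_fin payoffE//; have [tE wl_le] := wl i th' Thth'.
  exact: (win_lose_payoff_le mTh C_full C_ref (bx i) (@worst_win_nd i)
    Thth Thth' tE wl_le (payoffE i th' Thth')).
rewrite /Umin UrepE// lee_fin payoffE//.
by have /andP[] :=
  rent_bounds mTh C_full C_ref (bx i) (@x01 i) (@worst_win_nd i) Thth.
Qed.

Section InsuredTransfer.
Variable t : 'I_2 -> R -> R -> R.
Hypothesis t_admissible : admissibleP D P eta alpha beta K x t.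

Let bt i : bounded_mfun (Th `*` Th : set (R * T)) (fun p => t i p.1 p.2).
Proof. by apply: bounded_mfun_ThetaX; have [+ _ _] := t_admissible; exact. Qed.

Let t_ic i s th : s \in `[a, b] -> th \in `[a, b] ->
  bidder_payoff t i s th <= bidder_payoff t i s s.
Proof.
have [tr [ic _] _] := t_admissible => sab thab.
by rewrite -lee_fin -!UrepE//; exact: ic.
Qed.

Let t_ir i th : th \in `[a, b] -> 0 <= bidder_payoff t i th th.
Proof.
have [tr [_ ir] _] := t_admissible => thab.
by rewrite -lee_fin -UrepE//; exact: ir.
Qed.

Let C_stable : jeffrey_stable (Th : set T) P C.
Proof. exact: plausible_jeffrey_stable. Qed.

Let x_binary i th : th \in `[a, b] -> almost_binary (Th : set T) P (x i) th.
Proof.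
move=> thab; have [xbin _ _] := hX; have := atomless_ae_neq hPat thab.
by apply: filterS => y yth Thy; exact: xbin.
Qed.

Local Notation win i := (insured_win a (Th : set T) C P (x i) (t i)).
Local Notation lose i := (insured_lose a (Th : set T) C P (x i) (t i)).

Definition insured_transfer i : R -> R -> R :=
  insured a (Th : set T) C P (x i) (t i).

Lemma insured_transfer_rule : transfer_rule a b insured_transfer.
Proof.
move=> i; have mThR : measurable (Th : set R) by exact: measurable_itv.
have /bounded_measurableE bxi := hx.1 i.
have bwin : bounded_mfun (Th `*` Th : set (R * R)) (fun p => win i p.1).
  apply: bounded_mfun_fst => //.
  exact: (bounded_mfun_insured_win mTh C_full C_ref (bx i) (@x01 i)
    (@worst_win_nd i) (bt i)).
have blose : bounded_mfun (Th `*` Th : set (R * R)) (fun p => lose i p.1).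
  apply: bounded_mfun_fst => //.
  exact: (bounded_mfun_insured_lose mTh C_full C_ref (bx i) (@x01 i)
    (@worst_win_nd i) (bt i)).
by apply/bounded_measurableE; rewrite /insured_transfer /insured.
Qed.

Let Theta_ge0 th : Th th -> 0 <= th.
Proof.
rewrite /Theta/= in_itv/= => /andP[ath _]; have /andP[a0 _] := hab.
exact: le_trans (ltW a0) ath.
Qed.

Lemma insured_win_lose_dependent : win_lose_dependent a b x insured_transfer.
Proof.
exists (fun i => win i), (fun i => lose i) => i th Thth; split=> //.
have := spread_ge0 (Th : set T) P (x i) (t i) (Theta_ge0 Thth).
by rewrite -(insured_spread a _ C); lra.
Qed.

Lemma Umin_insured i th : Th th -> Umin D P eta x insured_transfer i th =
  (\int[lebesgue_measure]_(z in `[a, th]) Xmin D P eta x i z)%E.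
Proof.
move=> Thth; rewrite /Umin UrepE//; last exact: insured_transfer_rule.
rewrite integral_XminE//; congr EFin.
have th0 := Theta_ge0 Thth.
exact: (worst_payoff_insured mTh C_full C_ref (bx i) (t i) th0 Thth).
Qed.

Lemma revenue_le_insured : (revenue P t <= revenue P insured_transfer)%E.
Proof.
have [tr _ _] := t_admissible.
apply: revenue_le => //; first exact: insured_transfer_rule.
move=> i th Thth; exact: (mean_pay_le_insured mTh C_full C_ref (bx i) (@x01 i)
  (@worst_win_nd i) (bt i) (@t_ic i) (@t_ir i) C_stable (@x_binary i) Thth).
Qed.

Hypotheses (alpha_ge0 : 0 <= alpha) (alpha_beta : alpha <= beta).
Hypothesis K_ge0 : 0 <= K.

Lemma insured_in_Tclass : in_Tclass a b alpha beta K x insured_transfer.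
Proof.
move=> i th thw thl Thth thb Thw Thl xw xl; have [_ X1b _] := hX.
have [_ _ tT] := t_admissible.
rewrite /insured_transfer /insured xw xl !mulr1 !subrr !mulr0 addr0 add0r.
rewrite subr0 mulr1; apply: (insured_class mTh C_full C_ref (bx i) (@x01 i)
  (@worst_win_nd i) (bt i) (@t_ic i) (@t_ir i) C_stable (@x_binary i)) => //.
- apply: contra_ltN thb => /eqP X1; rewrite (X1b i th Thth)// -X1.
  by apply: TexpE => //; exact: hx.1.
- by move=> y z Thy Thz xy xz; exact: tT xy xz.
Qed.

Lemma insured_admissibleR :
  admissibleR D P eta alpha beta K x insured_transfer.
Proof.
split; [exact: insured_transfer_rule|exact: insured_win_lose_dependent| |].
  exact: Umin_insured.
exact: insured_in_Tclass.
Qed.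

End InsuredTransfer.
End Auction.

Theorem theorem1 (R : realType) (a b : R) (hab : 0 < a < b)
  (D : divergence) (hD : @assumptionD R a b D)
  (P : probability (gsT (BorelTheta a b)) R) (hP : isProbTheta a b P)
  (hPat : @atomless R a b P) (eta : R) (heta : 0 < eta)
  (x : 'I_2 -> R -> R -> R) (hx : @allocation_rule R a b x)
  (hX : @assumptionX R a b D P eta x)
  (alpha beta K : R) (halpha : 0 <= alpha) (hab' : alpha <= beta) (hbeta : beta <= 1)
  (hK : 0 <= K)
  (t : 'I_2 -> R -> R -> R) :
  @solvesR R a b D P eta alpha beta K x t -> @solvesP R a b D P eta alpha beta K x t.
Proof.
move=> [tR t_max]; split=> [|t' t'P].
  exact: (admissibleR_admissibleP hD hP heta hx hX tR).
apply: le_trans (revenue_le_insured hD hP hPat heta hx hX t'P) _.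
apply: t_max.
exact: (insured_admissibleR hab hD hP hPat heta hx hX t'P halpha hab' hK).
Qed.
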